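(* Let $\Gamma$ be a finite connected simplicial graph and let $[v]$ be a maximal equivalence class of vertices of $\Gamma$. Then there are a well-defined restriction homomorphism $R_{[v]}: Out^0(A_\Gamma)\to Out(A_{J_{[v]}})$ and a well-defined projection homomorphism $P_{[v]}: Out^0(A_\Gamma)\to Out(A_{L_{[v]}})$, given as follows: for $\phi\in Out^0(A_\Gamma)$, choose a representative $\phi_v\in Aut^0(A_\Gamma)$ of $\phi$ which preserves both $A_{[v]}$ and $A_{J_{[v]}}$ (such a representative exists); then $R_{[v]}(\phi)$ is the class in $Out(A_{J_{[v]}})$ of the restriction of $\phi_v$ to $A_{J_{[v]}}$, and $P_{[v]}(\phi)$ is the class in $Out(A_{L_{[v]}})$ of the automorphism induced by $\phi_v$ on $A_{J_{[v]}}/A_{[v]}\cong A_{L_{[v]}}$.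
   Context: $A_\Gamma$ is the right-angled Artin group of $\Gamma$: generators are the vertices, relations are $vw=wv$ for adjacent $v,w$. For a subgraph (or set of vertices) $\Theta$, $A_\Theta\le A_\Gamma$ denotes the subgroup generated by the vertices of $\Theta$. The link $lk(v)$ is the subgraph spanned by vertices at distance one from $v$, and the star $st(v)$ is the subgraph spanned by vertices at distance at most one. For vertices $v,w$ set $v\le w$ if $lk(v)\subseteq st(w)$; this relation is transitive. Write $v\sim w$ if $v\le w$ and $w\le v$; this is an equivalence relation, $[v]$ is the class of $v$, and $\le$ induces a partial order on classes; ''maximal'' refers to this partial order. Put $L_{[v]}=lk(v)\setminus[v]$ and $J_{[v]}=L_{[v]}\ast[v]$ (the subgraph spanned by $L_{[v]}\cup[v]$; every vertex of $L_{[v]}$ is adjacent to every vertex of $[v]$), so $A_{J_{[v]}}=A_{L_{[v]}}\times A_{[v]}$. The pure automorphism group $Aut^0(A_\Gamma)\le Aut(A_\Gamma)$ is the subgroup generated by: inner automorphisms; inversions (sending one vertex generator to its inverse and fixing the others); transvections $v\mapsto vw$ for distinct vertices with $v\le w$ (fixing the other generators); and partial conjugations (for a vertex $v$ such that $\Gamma-st(v)$ is disconnected, conjugating by $v$ all the generators in one component of $\Gamma-st(v)$ and fixing the other generators). $Out^0(A_\Gamma)$ is the image of $Aut^0(A_\Gamma)$ in $Out(A_\Gamma)$. *)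

(* Defs.v *)
From HB Require Import structures.
From mathcomp Require Import all_boot.
From mathcomp Require Import boolp classical_sets.

Set Implicit Arguments.
Unset Strict Implicit.
Unset Printing Implicit Defensive.

Local Open Scope group_scope.
Local Open Scope quotient_scope.

Record subgroup (G : groupType) := Subgroup {
  carrier :> G -> Prop;
  sub1 : carrier 1;
  subM : forall x y, carrier x -> carrier y -> carrier (x * y);
  subV : forall x, carrier x -> carrier x^-1
}.

Section SubgroupType.
Variables (G : groupType) (H : subgroup G).

Definition subg := {x : G | x \in (carrier H : set G)}.

HB.instance Definition _ := SubChoice.on subg.

Lemma subg_closed : group_closed [pred x | x \in (carrier H : set G)].
Proof.
split=> [|x y]; rewrite !inE; first exact: sub1.
by move=> Hx Hy; apply: subM => //; apply: subV.
Qed.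

HB.instance Definition _ := SubChoice_isSubGroup.Build G _ subg subg_closed.

Definition to_subg (x : G) (Hx : H x) : subg := exist _ x (mem_set Hx).

Lemma subgP (x : subg) : H (val x).
Proof. exact: set_mem (valP x). Qed.

End SubgroupType.

Section SubgroupOps.
Variables (G G' : groupType).

Inductive generated_set (S : set G) : set G :=
| gen_in x of S x : generated_set S x
| gen_1 : generated_set S 1
| gen_M x y of generated_set S x & generated_set S y : generated_set S (x * y)
| gen_V x of generated_set S x : generated_set S x^-1.

Definition generated (S : set G) : subgroup G :=
  Subgroup (gen_1 S) (@gen_M S) (@gen_V S).

Definition incl (H K : subgroup G) (HK : forall x, H x -> K x) (x : subg H) :
  subg K := to_subg (HK _ (subgP x)).

Lemma preim1 (H K : subgroup G) : H (val (1 : subg K)).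
Proof. exact: sub1. Qed.

Lemma preimM (H K : subgroup G) (x y : subg K) :
  H (val x) -> H (val y) -> H (val (x * y)).
Proof. exact: subM. Qed.

Lemma preimV (H K : subgroup G) (x : subg K) : H (val x) -> H (val x^-1).
Proof. exact: subV. Qed.

(* [subg_in H K] is the intersection of H and K, regarded as a subgroup of [K]. *)
Definition subg_in (H K : subgroup G) : subgroup (subg K) :=
  @Subgroup (subg K) (fun x => H (val x)) (@preim1 H K) (@preimM H K) (@preimV H K).

Variable f : G -> G'.
Hypothesis fM : {morph f : x y / x * y}.

Lemma morph1 : f 1 = 1.
Proof. by apply: (@mulgI _ (f 1)); rewrite -fM !mulg1. Qed.

Lemma morphV x : f x^-1 = (f x)^-1.
Proof. by apply: (@mulgI _ (f x)); rewrite -fM !mulgV morph1. Qed.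

Variable H : subgroup G.

Definition img_set : set G' := fun y => exists2 x, H x & f x = y.

Lemma img1 : img_set 1.
Proof. by exists 1; [exact: sub1 | exact: morph1]. Qed.

Lemma imgM x y : img_set x -> img_set y -> img_set (x * y).
Proof.
by case=> a Ha <- [b Hb <-]; exists (a * b); [exact: subM | exact: fM].
Qed.

Lemma imgV x : img_set x -> img_set x^-1.
Proof. by case=> a Ha <-; exists a^-1; [exact: subV | exact: morphV]. Qed.

Definition img : subgroup G' := Subgroup img1 imgM imgV.

End SubgroupOps.

Record normal_subgroup (G : groupType) := NormalSubgroup {
  normal_sub :> subgroup G;
  normalJ : forall x g, normal_sub x -> normal_sub (g * x * g^-1)
}.

Section Quotient.
Variables (G : groupType) (N : normal_subgroup G).

Definition coset_rel : rel G := fun x y => `[< N (x^-1 * y) >].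

Lemma coset_refl : reflexive coset_rel.
Proof. by move=> x; apply/asboolP; rewrite mulVg; apply: sub1. Qed.

Lemma coset_sym : symmetric coset_rel.
Proof.
have imp x y : coset_rel x y -> coset_rel y x.
  by move/asboolP/subV; rewrite invgM invgK => ?; apply/asboolP.
by move=> x y; apply/idP/idP; apply: imp.
Qed.

Lemma coset_trans : transitive coset_rel.
Proof.
move=> y x z /asboolP xy /asboolP yz; apply/asboolP.
by have := subM xy yz; rewrite -mulgA mulVKg.
Qed.

Canonical coset_equiv := EquivRel coset_rel coset_refl coset_sym coset_trans.

Definition quot := {eq_quot coset_equiv}.
HB.instance Definition _ := Choice.on quot.
HB.instance Definition _ := EqQuotient.on quot.

Definition proj (x : G) : quot := \pi_quot x.

Lemma projP x y : proj x = proj y <-> N (x^-1 * y).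
Proof. by split=> [/eqquotP/asboolP|] // ?; apply/eqquotP/asboolP. Qed.

Lemma projK (q : quot) : proj (repr q) = q.
Proof. exact: reprK. Qed.

Definition quot_one : quot := proj 1.
Definition quot_mul (p q : quot) : quot := proj (repr p * repr q).
Definition quot_inv (p : quot) : quot := proj (repr p)^-1.

Lemma projMP x y : quot_mul (proj x) (proj y) = proj (x * y).
Proof.
apply/projP; set x' := repr _; set y' := repr _.
have /projP Nx : proj x' = proj x by rewrite projK.
have /projP Ny : proj y' = proj y by rewrite projK.
have -> : (x' * y')^-1 * (x * y) = (y'^-1 * (x'^-1 * x) * y') * (y'^-1 * y).
  by rewrite invgM -!mulgA mulVKg.
apply: subM Ny.
by have := normalJ y'^-1 Nx; rewrite invgK.
Qed.

Lemma projVP x : quot_inv (proj x) = proj x^-1.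
Proof.
apply/projP; rewrite invgK; set x' := repr _.
have /projP Nx : proj x = proj x' by rewrite projK.
by have := normalJ x Nx; rewrite mulVKg.
Qed.

Lemma quot_mulA : associative quot_mul.
Proof.
move=> x y z; rewrite -(projK x) -(projK y) -(projK z).
by rewrite !projMP mulgA.
Qed.

Lemma quot_mul1 : left_id quot_one quot_mul.
Proof. by move=> x; rewrite -(projK x) projMP mul1g. Qed.

Lemma quot_1mul : right_id quot_one quot_mul.
Proof. by move=> x; rewrite -(projK x) projMP mulg1. Qed.

Lemma quot_mulV : left_inverse quot_one quot_inv quot_mul.
Proof. by move=> x; rewrite -(projK x) projVP projMP mulVg. Qed.

Lemma quot_Vmul : right_inverse quot_one quot_inv quot_mul.
Proof. by move=> x; rewrite -(projK x) projVP projMP mulgV. Qed.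

HB.instance Definition _ :=
  isGroup.Build quot quot_mulA quot_mul1 quot_1mul quot_mulV quot_Vmul.

Lemma projM : {morph proj : x y / x * y}.
Proof. by move=> x y; rewrite -projMP. Qed.

HB.instance Definition _ := isMultiplicative.Build G quot proj projM.

End Quotient.

Record aut (G : groupType) := Automorphism {
  aut_fun :> G -> G;
  autM : {morph aut_fun : x y / x * y};
  aut_bij : bijective aut_fun
}.

Section Aut.
Variable G : groupType.

HB.instance Definition _ := gen_eqMixin (aut G).
HB.instance Definition _ := gen_choiceMixin (aut G).
HB.instance Definition _ (f : aut G) := isMultiplicative.Build G G f (autM f).

Lemma autP (f g : aut G) : f =1 g -> f = g.
Proof.
case: f g => [f fM fb] [g gM gb] /= /funext fg; subst g.
by rewrite (Prop_irrelevance fM gM) (Prop_irrelevance fb gb).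
Qed.

Definition aut_one : aut G :=
  @Automorphism G id (fun _ _ => erefl) (Bijective (fun _ => erefl) (fun _ => erefl)).

Lemma aut_compM (f g : aut G) : {morph f \o g : x y / x * y}.
Proof. by move=> x y /=; rewrite !autM. Qed.

Definition aut_mul (f g : aut G) : aut G :=
  Automorphism (aut_compM f g) (bij_comp (aut_bij f) (aut_bij g)).

Lemma aut_invP (f : aut G) : exists g : aut G, cancel f g /\ cancel g f.
Proof.
have [g fK gK] := aut_bij f; have gM : {morph g : x y / x * y}.
  by move=> x y; apply: (can_inj fK); rewrite autM !gK.
by exists (Automorphism gM (Bijective gK fK)).
Qed.

Definition aut_inv (f : aut G) : aut G := projT1 (cid (aut_invP f)).

Lemma aut_invK (f : aut G) : cancel f (aut_inv f).
Proof. by rewrite /aut_inv; case: cid => g []. Qed.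

Lemma aut_Kinv (f : aut G) : cancel (aut_inv f) f.
Proof. by rewrite /aut_inv; case: cid => g []. Qed.

Lemma aut_mulA : associative aut_mul. Proof. by move=> *; apply: autP. Qed.
Lemma aut_mul1 : left_id aut_one aut_mul. Proof. by move=> *; apply: autP. Qed.
Lemma aut_1mul : right_id aut_one aut_mul. Proof. by move=> *; apply: autP. Qed.
Lemma aut_mulV : left_inverse aut_one aut_inv aut_mul.
Proof. by move=> f; apply: autP => x /=; apply: aut_invK. Qed.
Lemma aut_Vmul : right_inverse aut_one aut_inv aut_mul.
Proof. by move=> f; apply: autP => x /=; apply: aut_Kinv. Qed.

HB.instance Definition _ :=
  isGroup.Build (aut G) aut_mulA aut_mul1 aut_1mul aut_mulV aut_Vmul.

Definition is_inner : set (aut G) :=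
  fun f => exists g : G, forall x, f x = g * x * g^-1.

Lemma inn1 : is_inner 1.
Proof. by exists 1 => x; rewrite mul1g invg1 mulg1. Qed.

Lemma innM f h : is_inner f -> is_inner h -> is_inner (f * h).
Proof.
move=> [a fa] [b hb]; exists (a * b) => x.
have -> : (f * h) x = f (h x) by [].
by rewrite hb fa invgM !mulgA.
Qed.

Lemma innV f : is_inner f -> is_inner f^-1.
Proof.
move=> [a fa]; exists a^-1 => x; apply: (can_inj (aut_invK f)).
have -> : f (f^-1 x) = x by apply: aut_Kinv.
by rewrite fa invgK !mulgA mulgV mul1g mulgK.
Qed.

Lemma innJ f h : is_inner f -> is_inner (h * f * h^-1).
Proof.
move=> [a fa]; exists (h a) => x.
have -> : (h * f * h^-1) x = h (f (h^-1 x)) by [].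
have -> : (h a)^-1 = h a^-1 by rewrite (morphV (autM h)).
have {2}-> : x = h (h^-1 x) by rewrite [RHS]aut_Kinv.
by rewrite fa !autM.
Qed.

Definition inn : normal_subgroup (aut G) :=
  @NormalSubgroup _ (Subgroup inn1 innM innV) innJ.

Definition out := quot inn.

HB.instance Definition _ := Group.on out.

Definition outer (f : aut G) : out := proj inn f.

End Aut.

Definition preserves (G : groupType) (f : aut G) (H : subgroup G) :=
  ([set f x | x in carrier H] = carrier H)%classic.

Definition restriction_of (G : groupType) (H : subgroup G) (f : aut G)
    (g : aut (subg H)) := forall x, val (g x) = f (val x).

Definition quotient_of (G : groupType) (N : normal_subgroup G) (f : aut G)
    (g : aut (quot N)) := forall x, g (proj N x) = proj N (f x).

Definition transports (G G' : groupType) (i : G -> G') (f : aut G)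
    (g : aut G') := forall x, i (f x) = g (i x).

Section Presentation.
Variables (V : finType).

(* [(x, true)] is the letter x and [(x, false)] is its formal inverse. *)
Definition word := seq (V * bool).

Variable R : word -> word -> Prop.

Inductive pres_eq : word -> word -> Prop :=
| pres_refl w : pres_eq w w
| pres_sym u w of pres_eq u w : pres_eq w u
| pres_trans w u t of pres_eq u w & pres_eq w t : pres_eq u t
| pres_cancel a x b c : pres_eq (a ++ (x, b) :: (x, ~~ b) :: c) (a ++ c)
| pres_rel a u w c of R u w : pres_eq (a ++ u ++ c) (a ++ w ++ c).

Definition pres_rel_bool : rel word := fun u w => `[< pres_eq u w >].

Lemma pres_rel_refl : reflexive pres_rel_bool.
Proof. by move=> w; apply/asboolP; apply: pres_refl. Qed.

Lemma pres_rel_sym : symmetric pres_rel_bool.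
Proof.
by move=> u w; apply/asboolP/asboolP; apply: pres_sym.
Qed.

Lemma pres_rel_trans : transitive pres_rel_bool.
Proof.
by move=> w u t /asboolP uw /asboolP wt; apply/asboolP; apply: pres_trans wt.
Qed.

Canonical pres_equiv :=
  EquivRel pres_rel_bool pres_rel_refl pres_rel_sym pres_rel_trans.

Definition presented := {eq_quot pres_equiv}.
HB.instance Definition _ := Choice.on presented.
HB.instance Definition _ := EqQuotient.on presented.

Definition wcls (w : word) : presented := \pi_presented w.

Lemma wclsP u w : wcls u = wcls w <-> pres_eq u w.
Proof. by split=> [/eqquotP/asboolP|] // ?; apply/eqquotP/asboolP. Qed.

Lemma wclsK (q : presented) : wcls (repr q) = q.
Proof. exact: reprK. Qed.

Definition winv (w : word) : word := rev [seq (p.1, ~~ p.2) | p <- w].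

Lemma pres_cat_l a u w : pres_eq u w -> pres_eq (a ++ u) (a ++ w).
Proof.
elim=> [? | ? ? _ | ? ? ? _ + _ | b x e c | b s t c Rst].
- exact: pres_refl.
- exact: pres_sym.
- exact: pres_trans.
- by rewrite !catA; apply: pres_cancel.
- by rewrite !(catA a b); apply: pres_rel.
Qed.

Lemma pres_cat_r a u w : pres_eq u w -> pres_eq (u ++ a) (w ++ a).
Proof.
elim=> [? | ? ? _ | ? ? ? _ + _ | b x e c | b s t c Rst].
- exact: pres_refl.
- exact: pres_sym.
- exact: pres_trans.
- by rewrite -!catA /=; apply: pres_cancel.
- by rewrite -!catA; apply: pres_rel.
Qed.

Lemma pres_cat u u' w w' :
  pres_eq u u' -> pres_eq w w' -> pres_eq (u ++ w) (u' ++ w').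
Proof.
by move=> uu' ww'; apply: pres_trans (pres_cat_r w uu') (pres_cat_l u' ww').
Qed.

Lemma winv_cat u w : winv (u ++ w) = winv w ++ winv u.
Proof. by rewrite /winv map_cat rev_cat. Qed.

Lemma winvK : involutive winv.
Proof.
move=> w; rewrite /winv map_rev revK -map_comp -[RHS]map_id.
by apply: eq_map => -[x b] /=; rewrite negbK.
Qed.

Lemma winv_cancel w : pres_eq (w ++ winv w) [::].
Proof.
elim: w => [|[x b] w IHw]; first exact: pres_refl.
rewrite -cat1s winv_cat -catA (catA w).
apply: pres_trans (pres_cancel [::] x b [::]).
rewrite -[(x, b) :: _]cat1s; apply: pres_cat_l => /=.
by rewrite -[[:: (x, ~~ b)] in X in pres_eq _ X]cat0s; apply: pres_cat_r.
Qed.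

Lemma winv_cancel' w : pres_eq (winv w ++ w) [::].
Proof. by rewrite -{2}[w]winvK; apply: winv_cancel. Qed.

Definition pres_one : presented := wcls [::].
Definition pres_mul (p q : presented) : presented := wcls (repr p ++ repr q).
Definition pres_inv (p : presented) : presented := wcls (winv (repr p)).

Lemma wcls_mul u w : pres_mul (wcls u) (wcls w) = wcls (u ++ w).
Proof. by apply/wclsP/pres_cat; apply/wclsP; rewrite wclsK. Qed.

Lemma wcls_inv w : pres_inv (wcls w) = wcls (winv w).
Proof.
apply/wclsP; set w' := repr _; have ww' : pres_eq w w'.
  by apply/wclsP; rewrite wclsK.
apply: (@pres_trans (winv w' ++ w ++ winv w)).
  rewrite -[X in pres_eq X]cats0; apply: pres_cat_l.
  exact/pres_sym/winv_cancel.
rewrite catA -[X in pres_eq _ X]cat0s; apply: pres_cat_r.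
by apply: pres_trans (pres_cat_l _ ww') (winv_cancel' w').
Qed.

Lemma pres_mulA : associative pres_mul.
Proof.
move=> x y z; rewrite -(wclsK x) -(wclsK y) -(wclsK z).
by rewrite !wcls_mul catA.
Qed.

Lemma pres_mul1 : left_id pres_one pres_mul.
Proof. by move=> x; rewrite -(wclsK x) wcls_mul. Qed.

Lemma pres_1mul : right_id pres_one pres_mul.
Proof. by move=> x; rewrite -(wclsK x) wcls_mul cats0. Qed.

Lemma pres_mulV : left_inverse pres_one pres_inv pres_mul.
Proof.
move=> x; rewrite -(wclsK x) wcls_inv wcls_mul.
exact/wclsP/winv_cancel'.
Qed.

Lemma pres_Vmul : right_inverse pres_one pres_inv pres_mul.
Proof.
move=> x; rewrite -(wclsK x) wcls_inv wcls_mul.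
exact/wclsP/winv_cancel.
Qed.

HB.instance Definition _ :=
  isGroup.Build presented pres_mulA pres_mul1 pres_1mul pres_mulV pres_Vmul.

Definition letter (x : V) : presented := wcls [:: (x, true)].

Lemma wclsM u w : wcls (u ++ w) = wcls u * wcls w.
Proof. by rewrite -wcls_mul. Qed.

Lemma letterV x : (letter x)^-1 = wcls [:: (x, false)].
Proof. exact: wcls_inv. Qed.

Section Universal.
Variables (G : groupType) (f : V -> G).

Definition eval (w : word) : G :=
  foldr (fun p g => (if p.2 then f p.1 else (f p.1)^-1) * g) 1 w.

Lemma eval_cat u w : eval (u ++ w) = eval u * eval w.
Proof. by elim: u => [|p u IHu] /=; rewrite ?mul1g // IHu mulgA. Qed.

Hypothesis fR : forall u w, R u w -> eval u = eval w.

Lemma eval_pres u w : pres_eq u w -> eval u = eval w.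
Proof.
elim=> [// | // | ? ? ? _ -> _ // | a x b c | a s t c Rst].
  by rewrite !eval_cat /=; case: b; rewrite /= ?mulKg ?mulVKg.
by rewrite !eval_cat (fR Rst).
Qed.

Lemma universal : exists h : presented -> G,
  {morph h : x y / x * y} /\ forall x, h (letter x) = f x.
Proof.
have evK w : eval (repr (wcls w)) = eval w.
  by apply: eval_pres; apply/wclsP; rewrite wclsK.
exists (fun q => eval (repr q)); split=> [p q | x].
  by rewrite -(wclsK p) -(wclsK q) -wclsM !evK eval_cat.
by rewrite evK /= mulg1.
Qed.

End Universal.
End Presentation.

Record sgraph := SGraph {
  vertex :> finType;
  adj : rel vertex;
  adj_sym : symmetric adj;
  adj_irr : irreflexive adj
}.

Section Graph.
Variable Gamma : sgraph.
Implicit Types v w x : Gamma.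

Definition connected := forall x y, connect (@adj Gamma) x y.

Definition lk v : {set Gamma} := [set w | adj v w].
Definition st v : {set Gamma} := v |: lk v.

Definition vle v w := lk v \subset st w.
Definition veq v w := vle v w && vle w v.
Definition vclass v : {set Gamma} := [set w | veq v w].

(* [v] is maximal for the partial order induced by vle on the classes. *)
Definition maximal_class v := forall w, vle v w -> vclass w = vclass v.

Definition L_of v := lk v :\: vclass v.
Definition J_of v := L_of v :|: vclass v.

(* Adjacency in Gamma - st(v), extended by false to all of Gamma; hence components
   are only taken at base points outside st(v). *)
Definition off_star v : rel Gamma :=
  [rel x y | [&& adj x y, x \notin st v & y \notin st v]].

Definition off_star_disconnected v := exists x y,
  [/\ x \notin st v, y \notin st v & ~~ connect (off_star v) x y].

Definition off_star_component v (C : {set Gamma}) := exists2 x,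
  x \notin st v & C = [set y | connect (off_star v) x y].

Inductive raag_rel : word Gamma -> word Gamma -> Prop :=
| raag_comm v w of adj v w :
    raag_rel [:: (v, true); (w, true)] [:: (w, true); (v, true)].

Definition raag := presented raag_rel.
HB.instance Definition _ := Group.on raag.

Definition gen v : raag := letter raag_rel v.

Definition special (T : {set Gamma}) : subgroup raag :=
  generated (fun g => exists2 v, v \in T & g = gen v).

(* The next three predicates prescribe f on the generators only, which determines
   the automorphism f. *)
Definition is_inversion (f : aut raag) := exists v,
  f (gen v) = (gen v)^-1 /\ forall x, x != v -> f (gen x) = gen x.

Definition is_transvection (f : aut raag) := exists v w,
  [/\ v != w, vle v w, f (gen v) = gen v * gen w &
      forall x, x != v -> f (gen x) = gen x].

Definition is_partial_conj (f : aut raag) := exists v C,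
  [/\ off_star_disconnected v, off_star_component v C,
      forall x, x \in C -> f (gen x) = gen v * gen x * (gen v)^-1 &
      forall x, x \notin C -> f (gen x) = gen x].

Definition Aut0 : subgroup (aut raag) :=
  generated (fun f => [\/ is_inner f, is_inversion f, is_transvection f
                        | is_partial_conj f]).

Definition Out0 : subgroup (out raag) := img (@projM _ (inn raag)) Aut0.

Lemma gen_comm v w : adj v w -> gen v * gen w = gen w * gen v.
Proof.
move=> vw; rewrite /gen /letter -!wclsM /=; apply/wclsP.
exact: (pres_rel [::] [::] (raag_comm vw)).
Qed.

Lemma L_of_class_adj v x y : x \in L_of v -> y \in vclass v -> adj x y.
Proof.
rewrite !inE => /andP[nvx vx] /andP[vy yv].
have /(fintype.subsetP vy) : x \in lk v by rewrite inE.
rewrite !inE => /orP[/eqP xy | ]; last by rewrite adj_sym.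
by case/negP: nvx; rewrite xy /veq vy yv.
Qed.

Lemma specialS (S T : {set Gamma}) : S \subset T ->
  forall g, special S g -> special T g.
Proof.
move=> ST g; elim=> [{}g [w wS ->] | | y z _ Ty _ Tz | y _ Ty].
- by apply: gen_in; exists w => //; apply: (fintype.subsetP ST).
- exact: sub1.
- exact: subM.
- exact: subV.
Qed.

Lemma L_sub_J v : L_of v \subset J_of v.
Proof. exact: finset.subsetUl. Qed.

End Graph.

Section ClassQuotient.
Variables (Gamma : sgraph) (v : Gamma).

Notation A_v := (special (vclass v)).
Notation A_L := (special (L_of v)).
Notation A_J := (special (J_of v)).

Lemma commute_class w g : w \in L_of v -> A_v g -> gen w * g = g * gen w.
Proof.
move=> wL; elim=> [_ [x xv ->] | | x y _ xC _ yC | x _ xC].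
- exact/gen_comm/L_of_class_adj/xv.
- by rewrite mulg1 mul1g.
- by rewrite mulgA xC -mulgA yC mulgA.
- by apply: (mulgI x); rewrite mulgA -xC mulgK mulVKg.
Qed.

Lemma class_conj g x :
  A_J g -> A_v x -> A_v (g * x * g^-1) /\ A_v (g^-1 * x * g).
Proof.
move=> Jg; elim: Jg x => {g} [_ [w wJ ->] x vx | x vx
    | g h _ IHg _ IHh x vx | g _ IHg x vx].
- have := wJ; rewrite finset.in_setU => /orP[wL | wv].
    by rewrite (commute_class wL vx) mulgK -mulgA -(commute_class wL vx) mulKg.
  have vw : A_v (gen w) by apply: gen_in; exists w.
  by split; do !apply: subM => //; apply: subV.
- by rewrite invg1 !mulg1 !mul1g.
- rewrite invgM; split.
    have [/IHg[]] := IHh _ vx; by rewrite !mulgA.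
  have [_ /IHh[]] := IHg _ vx; by rewrite !mulgA.
- by rewrite invgK; have [] := IHg _ vx.
Qed.

Lemma class_normal_in (x g : subg A_J) :
  subg_in A_v A_J x -> subg_in A_v A_J (g * x * g^-1).
Proof. by move/(class_conj (subgP g)) => []. Qed.

Definition class_in_J : normal_subgroup (subg A_J) :=
  NormalSubgroup class_normal_in.

(* The composite A_L -> A_J -> A_J / A_[v]; by [L_isoM] and [L_iso_bij] below it
   is the isomorphism along which automorphisms of the quotient are read on A_L. *)
Definition L_iso (x : subg A_L) : quot class_in_J :=
  proj class_in_J (incl (specialS (L_sub_J v)) x).

Lemma L_isoM : {morph L_iso : x y / x * y}.
Proof.
by move=> x y; rewrite /L_iso -projM; congr (proj _ _); apply: val_inj.
Qed.

Lemma kill_class : exists r : raag Gamma -> raag Gamma,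
  [/\ {morph r : x y / x * y}, forall x, A_v x -> r x = 1 &
      forall x, A_L x -> r x = x].
Proof.
pose f x : raag Gamma := if x \in vclass v then 1 else gen x.
have [|r [rM rf]] := @universal _ (@raag_rel Gamma) _ f.
  move=> _ _ [x y xy]; rewrite /= !mulg1 /f.
  by case: ifP; case: ifP; rewrite ?mulg1 ?mul1g // gen_comm.
exists r; split=> // x.
  elim=> [_ [w wv ->] | | y z _ r1 _ r2 | y _ r1].
  - by rewrite rf /f wv.
  - exact: (morph1 rM).
  - by rewrite rM r1 r2 mulg1.
  - by rewrite (morphV rM) r1 invg1.
elim=> [_ [w wL ->] | | y z _ r1 _ r2 | y _ r1].
- by rewrite rf /f; move: wL; rewrite inE => /andP[/negbTE ->].
- exact: (morph1 rM).
- by rewrite rM r1 r2.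
- by rewrite (morphV rM) r1.
Qed.

Lemma L_factor g : A_J g -> exists2 l, A_L l & A_v (l^-1 * g).
Proof.
elim=> {g} [_ [w wJ ->] | | g h Jg [l Ll vg] Jh [m Lm vh] | g Jg [l Ll vg]].
- move: wJ; rewrite finset.in_setU => /orP[wL | wv].
    exists (gen w); first by apply: gen_in; exists w.
    by rewrite mulVg; apply: sub1.
  exists 1; first exact: sub1.
  by rewrite invg1 mul1g; apply: gen_in; exists w.
- by exists 1; [|rewrite invg1 mulg1]; apply: sub1.
- exists (l * m); first exact: subM.
  have [_ vgh] := class_conj Jh vg.
  have -> : (l * m)^-1 * (g * h) = m^-1 * h * (h^-1 * (l^-1 * g) * h).
    by rewrite invgM -!mulgA mulVKg.
  exact: subM.
- exists l^-1; first exact: subV.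
  have Jl : A_J l by apply: specialS Ll; apply: L_sub_J.
  have [/subV vlg _] := class_conj Jl vg.
  suff -> : l^-1^-1 * g^-1 = (l * (l^-1 * g) * l^-1)^-1 by [].
  by rewrite mulVKg invgM.
Qed.

Lemma L_iso_bij : bijective L_iso.
Proof.
have [r [rM rv rL]] := kill_class.
have L_inj : injective L_iso.
  move=> x y /projP /= vxy; apply: val_inj.
  have := rv _ vxy; rewrite rM (morphV rM) !rL; try exact: subgP.
  by move=> xy1; apply/esym/(mulgI (val x)^-1); rewrite mulVg.
have L_surj q : exists x, L_iso x == q.
  rewrite -(projK q); set g := repr q.
  have [l Ll vl] := L_factor (subgP g).
  by exists (to_subg Ll); apply/eqP/projP.
exists (fun q => xchoose (L_surj q)) => [x | q].
  by apply: L_inj; apply/eqP/(xchooseP (L_surj _)).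
exact/eqP/(xchooseP (L_surj q)).
Qed.

End ClassQuotient.

(* Main.v *)
(* Every generator of Aut^0 can be adjusted by an inner automorphism so as to
   preserve A_[v] and A_J: maximality of [v] forces the multiplier of a
   transvection of a vertex of [v] (resp. J) to lie in [v] (resp. J), and puts
   J - st(x) in a single component of Gamma - st(x) when x is not in J, so that
   a partial conjugation by such an x acts on A_J as 1 or as conjugation by x.
   For well-definedness, let g normalise A_J and let r : A_Gamma -> A_J be the
   retraction killing the vertices outside J; then for x in A_J,
   g x g^-1 = r (g x g^-1) = r(g) x r(g)^-1, so conjugation by g restricts to an
   inner automorphism of A_J. *)
From HB Require Import structures.
Require Import Defs.
From mathcomp Require Import all_boot.
From mathcomp Require Import boolp classical_sets.

Set Implicit Arguments.
Unset Strict Implicit.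
Unset Printing Implicit Defensive.

Local Open Scope group_scope.

(** * Automorphisms preserving a subgroup, and the maps they induce *)

Section Preserves.
Variable G : groupType.
Implicit Types (f g : aut G) (H : subgroup G).

(** The onto half is what makes a restriction surjective and an induced map on a quotient injective,
    so it is kept apart from stability. *)
Lemma preservesP f H :
  preserves f H <->
  (forall x, H x -> H (f x)) /\ (forall y, H y -> exists2 x, H x & f x = y).
Proof.
split=> [fH | [fH Hf]].
  split=> [x Hx | y Hy].
    by rewrite -[carrier H]fH; exists x.
  by move: Hy; rewrite -{1}[carrier H]fH.
by apply/seteqP; split=> [_ [x Hx <-] | y /Hf //]; apply: fH.
Qed.

Lemma preserves1 H : preserves 1 H.
Proof. by apply/preservesP; split=> // y Hy; exists y. Qed.

Lemma preservesM f g H : preserves f H -> preserves g H -> preserves (f * g) H.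
Proof.
move=> /preservesP[fH Hf] /preservesP[gH Hg]; apply/preservesP; split.
  by move=> x /gH/fH.
by move=> _ /Hf[_ /Hg[x Hx <-] <-]; exists x.
Qed.

Lemma preservesV f H : preserves f H -> preserves f^-1 H.
Proof.
move=> /preservesP[fH Hf]; apply/preservesP; split.
  by move=> _ /Hf[x Hx <-]; rewrite (_ : f^-1 (f x) = x) //; apply: aut_invK.
by move=> y Hy; exists (f y); [exact: fH | exact: aut_invK].
Qed.

Lemma restriction_ex f H : preserves f H ->
  exists fH : aut (subg H), restriction_of f fH.
Proof.
move=> /preservesP[fH Hf].
pose r (x : subg H) : subg H := to_subg (fH _ (subgP x)).
have rM : {morph r : x y / x * y} by move=> x y; apply/val_inj/autM.
have r_inj : injective r.
  move=> x y /(congr1 val) /= fxy; apply: val_inj.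
  exact: (bij_inj (aut_bij f)).
have r_surj y : exists x, r x == y.
  have [x Hx fx] := Hf _ (subgP y); exists (to_subg Hx).
  by apply/eqP/val_inj.
have r_bij : bijective r.
  exists (fun y => xchoose (r_surj y)) => [x|y]; last exact/eqP/(xchooseP (r_surj y)).
  by apply/r_inj/eqP/(xchooseP (r_surj _)).
by exists (Automorphism rM r_bij).
Qed.

Lemma quotient_ex (N : normal_subgroup G) f : preserves f N ->
  exists fQ : aut (quot N), quotient_of f fQ.
Proof.
move=> /preservesP[fN Nf].
pose q (x : quot N) : quot N := proj N (f (repr x)).
have qE x : q (proj N x) = proj N (f x).
  apply/projP; rewrite -(morphV (autM f)) -autM; apply/fN/projP.
  by rewrite projK.
have qM : {morph q : x y / x * y}.
  by move=> x y; rewrite -(projK x) -(projK y) -projM !qE autM projM.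
(* If [f (x^-1 * y)] lies in [N], it is the image of an element of [N], and injectivity of [f] puts
   [x^-1 * y] itself in [N]. *)
have q_inj : injective q.
  move=> x y; rewrite -(projK x) -(projK y) !qE => /projP.
  rewrite -(morphV (autM f)) -autM => /Nf[z Nz fz]; apply/projP.
  by rewrite -(bij_inj (aut_bij f) fz).
have q_surj y : exists x, q x == y.
  by exists (proj N (f^-1 (repr y))); rewrite qE [f _]aut_Kinv projK.
have q_bij : bijective q.
  exists (fun y => xchoose (q_surj y)) => [x|y]; last exact/eqP/(xchooseP (q_surj y)).
  by apply/q_inj/eqP/(xchooseP (q_surj _)).
by exists (Automorphism qM q_bij).
Qed.

Lemma transports_ex (G' : groupType) (i : G -> G') (f : aut G') :
  {morph i : x y / x * y} -> bijective i -> exists g : aut G, transports i g f.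
Proof.
move=> iM i_bij; have [j iK jK] := i_bij.
have gM : {morph j \o f \o i : x y / x * y}.
  by move=> x y /=; apply: (can_inj iK); rewrite [RHS]iM !jK iM autM.
exists (Automorphism gM (bij_comp (bij_comp (Bijective jK iK) (aut_bij f)) i_bij)).
by move=> x /=; rewrite jK.
Qed.

Lemma outer_eq f g : outer f = outer g <-> is_inner (f^-1 * g).
Proof. exact: (projP (inn G)). Qed.

Lemma outerM f g : outer (f * g) = outer f * outer g.
Proof. exact: (projM (inn G)). Qed.

Lemma conj_aut (g : G) : exists f : aut G, forall x, f x = g * x * g^-1.
Proof.
have cM : {morph (fun x : G => g * x * g^-1) : x y / x * y}.
  by move=> x y; rewrite !mulgA mulgVK.
have c_bij : bijective (fun x : G => g * x * g^-1).
  exists (fun x => g^-1 * x * g) => x; first by rewrite !mulgA mulVg mul1g mulgVK.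
  by rewrite !mulgA mulgV mul1g mulgK.
by exists (Automorphism cM c_bij).
Qed.

End Preserves.

(** * Special subgroups: retractions and stability under the generators of Aut^0 *)

Section Special.
Variable Gamma : sgraph.
Implicit Types (T : {set Gamma}) (f : aut (raag Gamma)).

Lemma special_gen T x : x \in T -> special T (gen x).
Proof. by move=> xT; apply: gen_in; exists x. Qed.

Lemma preserves_special T f :
  (forall y, y \in T -> special T (f (gen y))) ->
  (forall y, y \in T -> exists2 z, special T z & f z = gen y) ->
  preserves f (special T).
Proof.
move=> fT Tf; apply/preservesP; split=> x.
  elim=> [_ [y yT ->] | | y z _ Ty _ Tz | y _ Ty].
  - exact: fT.
  - by rewrite (morph1 (autM f)); apply: sub1.
  - by rewrite autM; apply: subM.
  - by rewrite (morphV (autM f)); apply: subV.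
elim=> [_ [y yT ->] | | _ _ _ [a Ta <-] _ [b Tb <-] | _ _ [a Ta <-]].
- exact: Tf.
- by exists 1; [exact: sub1 | exact: (morph1 (autM f))].
- by exists (a * b); [exact: subM | rewrite autM].
- by exists a^-1; [exact: subV | exact: (morphV (autM f))].
Qed.

Lemma preserves_special_id T f :
  (forall y, y \in T -> f (gen y) = gen y) -> preserves f (special T).
Proof.
move=> fT; apply: preserves_special => y yT; first by rewrite fT //; apply: special_gen.
by exists (gen y); [exact: special_gen | exact: fT].
Qed.

Lemma special_retraction T : exists r : raag Gamma -> raag Gamma,
  [/\ {morph r : x y / x * y}, forall x, special T (r x) &
      forall x, special T x -> r x = x].
Proof.
pose f x : raag Gamma := if x \in T then gen x else 1.
have fT x : special T (f x).
  by rewrite /f; case: ifP => [/special_gen // | _]; apply: sub1.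
have [|r [rM rf]] := @universal _ (@raag_rel Gamma) _ f.
  move=> _ _ [x y xy]; rewrite /= !mulg1 /f.
  by case: ifP; case: ifP; rewrite ?mulg1 ?mul1g // gen_comm.
exists r; split=> // x.
  (* An arbitrary element is written as a word, and [r] sends each letter into [special T]. *)
  rewrite -(wclsK x); elim: (repr x) => [|[y b] w IHw].
    by rewrite (morph1 rM : r (wcls _ [::]) = 1); apply: sub1.
  rewrite -cat1s wclsM rM; apply: subM IHw.
  case: b; first by rewrite (rf y).
  by rewrite -letterV (morphV rM) rf; apply/subV/fT.
elim=> [_ [w wT ->] | | y z _ r1 _ r2 | y _ r1].
- by rewrite rf /f wT.
- exact: (morph1 rM).
- by rewrite rM r1 r2.
- by rewrite (morphV rM) r1.
Qed.

Lemma restriction_inner T f (fT : aut (subg (special T))) :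
  is_inner f -> restriction_of f fT -> is_inner fT.
Proof.
move=> [g fg] resf; have [r [rM rT rK]] := special_retraction T.
exists (to_subg (rT g)) => x; apply: val_inj.
(* The value [f (val x)] lies in [special T], so [r] fixes it; applying [r] replaces the conjugator
   [g] by [r g]. *)
rewrite resf -[LHS]rK; last by rewrite -resf; apply: subgP.
rewrite fg !rM (morphV rM) (rK (val x)) //; exact: subgP.
Qed.

Lemma inversion_preserves T f : is_inversion f -> preserves f (special T).
Proof.
case=> x [fx f_id]; apply: preserves_special => y yT; have Ty := special_gen yT.
  have [yx | /f_id -> //] := eqVneq y x.
  by move: Ty; rewrite yx fx; apply: subV.
have [yx | /f_id yE] := eqVneq y x; last by exists (gen y).
exists (gen y)^-1; first exact: subV.
by rewrite (morphV (autM f)) yx fx invgK.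
Qed.

Lemma transvection_preserves T f x y :
  x != y -> (x \in T -> y \in T) ->
  f (gen x) = gen x * gen y -> (forall z, z != x -> f (gen z) = gen z) ->
  preserves f (special T).
Proof.
move=> xy xyT fx f_id; apply: preserves_special => z zT; have Tz := special_gen zT.
  have [zx | /f_id -> //] := eqVneq z x; subst z.
  by rewrite fx; apply/subM/special_gen/xyT.
have [zx | /f_id ?] := eqVneq z x; last by exists (gen z).
subst z; exists (gen x * (gen y)^-1).
  by apply/subM/subV/special_gen/xyT.
by rewrite autM (morphV (autM f)) fx f_id 1?eq_sym // mulgK.
Qed.

Lemma partial_conj_preserves T (C : {set Gamma}) f x :
  x \in T -> x \notin C ->
  (forall z, z \in C -> f (gen z) = gen x * gen z * (gen x)^-1) ->
  (forall z, z \notin C -> f (gen z) = gen z) -> preserves f (special T).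
Proof.
move=> xT xC f_conj f_id; have Tx := special_gen xT.
apply: preserves_special => z zT; have Tz := special_gen zT.
  have [/f_conj -> | /f_id -> //] := boolP (z \in C).
  by do !apply: subM => //; apply: subV.
have [zC | /f_id ?] := boolP (z \in C); last by exists (gen z).
(* Since [x] is outside [C], [f] fixes [gen x], and this conjugate is the preimage of [gen z]. *)
exists ((gen x)^-1 * gen z * gen x).
  by do !apply: subM => //; apply: subV.
by rewrite !autM (morphV (autM f)) (f_conj z) // (f_id x) // !mulgA mulVg mul1g mulgVK.
Qed.

End Special.

(** * Maximal classes and representatives preserving both subgroups *)

Section Classes.
Variable Gamma : sgraph.
Implicit Types v w x y : Gamma.

Lemma in_lk v w : (w \in lk v) = adj v w.
Proof. by rewrite inE. Qed.

Lemma in_st v w : (w \in st v) = (w == v) || adj v w.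
Proof. by rewrite !inE. Qed.

Lemma vle_refl v : vle v v.
Proof. by apply/fintype.subsetP => w; rewrite in_lk in_st => ->; rewrite orbT. Qed.

Lemma vleP v w x : vle v w -> adj v x -> (x == w) || adj w x.
Proof. by move=> /fintype.subsetP vw vx; rewrite -in_st; apply: vw; rewrite in_lk. Qed.

Lemma vle_trans : transitive (@vle Gamma).
Proof.
move=> u v w vu uw; apply/fintype.subsetP => a; rewrite in_lk in_st => va.
have [au | ua] := orP (vleP vu va); last exact: (vleP uw).
(* In the case [a = u], [v] lies in lk(u), hence in st(w); unless [v = w], [w] lies in lk(v), hence
   in st(u). *)
rewrite (eqP au) in va *.
have uv : adj u v by rewrite adj_sym.
have [/eqP <- | wv] := orP (vleP uw uv); first by rewrite va orbT.
have vw : adj v w by rewrite adj_sym.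
have [/eqP -> | uw'] := orP (vleP vu vw); first by rewrite eqxx.
by rewrite adj_sym uw' orbT.
Qed.

Lemma vclass_refl v : v \in vclass v.
Proof. by rewrite inE /veq vle_refl. Qed.

Lemma in_J v x : (x \in J_of v) = (x \in vclass v) || adj v x.
Proof. by rewrite /J_of finset.in_setU finset.in_setD in_lk orbC; case: (x \in vclass v). Qed.

Variable v : Gamma.
Hypothesis v_max : maximal_class v.

Lemma vclass_up x y : x \in vclass v -> vle x y -> y \in vclass v.
Proof.
rewrite inE => /andP[vx _] /(vle_trans vx)/v_max <-; exact: vclass_refl.
Qed.

(** For [x] adjacent to [v], [v] lies in lk(x), hence in st(y), so [y] is [v] or a neighbour of
    [v]. *)
Lemma J_up x y : x \in J_of v -> vle x y -> y \in J_of v.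
Proof.
rewrite !in_J => /orP[xv /(vclass_up xv) -> // | vx xy].
have xv : adj x v by rewrite adj_sym.
have [/eqP <- | yv] := orP (vleP xy xv); first by rewrite vclass_refl.
by rewrite adj_sym yv orbT.
Qed.

(** A neighbour [x] of [y] lies in lk(y), hence in st(v), which is contained in J. *)
Lemma vclass_off_star x y : x \notin J_of v -> y \in vclass v -> y \notin st x.
Proof.
rewrite in_J negb_or => /andP[xv nvx] yv; rewrite in_st negb_or; apply/andP; split.
  by apply: contraNneq xv => <-.
apply/negP; rewrite adj_sym => yx; move: yv; rewrite inE => /andP[_ yv].
have [/eqP xv' | vx] := orP (vleP yv yx); last by rewrite vx in nvx.
by rewrite xv' vclass_refl in xv.
Qed.

Lemma off_star_connect_sym x : connect_sym (off_star x).
Proof.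
by apply: sym_connect_sym => y z; rewrite /off_star /= adj_sym [(y \notin _) && _]andbC.
Qed.

(** Vertices of J outside [v] are neighbours of [v]. For [y] in [v], maximality excludes [vle v x],
    so some [l] in lk(v) avoids st(x); as lk(v) is contained in st(y), [l] joins [v] to [y] or
    equals [y]. *)
Lemma J_off_star_connect x y :
  x \notin J_of v -> y \in J_of v -> y \notin st x -> connect (off_star x) v y.
Proof.
move=> xJ yJ yx; have vx := vclass_off_star xJ (vclass_refl v).
have [yv | nyv] := boolP (y \in vclass v); last first.
  move: yJ; rewrite in_J (negbTE nyv) /= => vy.
  by apply: connect1; rewrite /off_star /= vy vx yx.
have /fintype.subsetPn[l] : ~~ vle v x.
  by apply: contra xJ => vx'; rewrite in_J (vclass_up (vclass_refl v) vx').
rewrite in_lk => vl lx.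
have v_l : connect (off_star x) v l by apply: connect1; rewrite /off_star /= vl vx lx.
move: yv; rewrite inE => /andP[vy _].
have [/eqP <- // | yl] := orP (vleP vy vl).
by apply: (connect_trans v_l); apply: connect1; rewrite /off_star /= adj_sym yl lx yx.
Qed.

Lemma off_star_componentN x (C : {set Gamma}) y :
  off_star_component x C -> y \in C -> y \notin st x.
Proof.
case=> c cx ->; rewrite inE => /connectP[p cp ->] {y}.
elim: p c cx cp => //= z p IHp c _ /andP[/and3P[_ _ zx] /IHp]; exact.
Qed.

Let A_v := special (vclass v).
Let A_J := special (J_of v).

Lemma generator_representative f :
  [\/ is_inner f, is_inversion f, is_transvection f | is_partial_conj f] ->
  exists g, [/\ Aut0 Gamma g, outer g = outer f, preserves g A_v & preserves g A_J].
Proof.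
move=> f_gen; have Af : Aut0 Gamma f by apply: gen_in.
case: f_gen => [f_inn | f_inv | [x [y [xy lexy fx f_id]]] | [x [C [_ xC f_conj f_id]]]].
- exists 1; split; [exact: sub1 | | exact: preserves1 | exact: preserves1].
  by apply/outer_eq; rewrite invg1 mul1g.
- by exists f; split=> //; apply: inversion_preserves.
- exists f; split=> //; apply: (transvection_preserves xy) fx f_id => xT.
    exact: vclass_up xT lexy.
  exact: J_up xT lexy.
have C_off y : y \in C -> y \notin st x by apply: off_star_componentN.
have nxC : x \notin C by apply/negP => /C_off; rewrite in_st eqxx.
have [xJ | xJ] := boolP (x \in J_of v).
  exists f; split=> //; last exact: partial_conj_preserves nxC f_conj f_id.
  have [xv | nxv] := boolP (x \in vclass v).
    exact: partial_conj_preserves nxC f_conj f_id.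
  (* Here [x] is in L, so [v] lies in st(x) and misses [C]. *)
  apply: preserves_special_id => y yv; apply: f_id; apply/negP => /C_off.
  have xL : x \in L_of v.
    by move: xJ; rewrite in_J finset.in_setD in_lk (negbTE nxv).
  by rewrite in_st (L_of_class_adj xL yv) orbT.
have v_sub_J y : y \in vclass v -> y \in J_of v by rewrite in_J => ->.
(* J - st(x) lies entirely inside or entirely outside [C], according to the position of [v]. *)
have J_C y : y \in J_of v -> y \notin st x -> (y \in C) = (v \in C).
  move=> yJ yx; have vy := J_off_star_connect xJ yJ yx.
  case: xC => c _ ->; rewrite !inE.
  exact/esym/(same_connect_r (@off_star_connect_sym x) vy).
have [vC | nvC] := boolP (v \in C); last first.
  have f_J y : y \in J_of v -> f (gen y) = gen y.
    move=> yJ; apply: f_id; apply/negP => yC.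
    by case/negP: nvC; rewrite -(J_C y) // C_off.
  exists f; split=> //; last exact: preserves_special_id.
  by apply: preserves_special_id => y /v_sub_J/f_J.
(* When [v] is in [C], conjugation by the inverse of [gen x] undoes [f] on J - st(x). It also fixes
   the vertices of J in st(x), which commute with [x]. *)
have [c cE] := conj_aut (gen x)^-1.
have c_inn : is_inner c by exists (gen x)^-1.
have g_J y : y \in J_of v -> (c * f) (gen y) = gen y.
  move=> yJ; have -> : (c * f) (gen y) = c (f (gen y)) by [].
  rewrite cE invgK; have [yx | yx] := boolP (y \in st x); last first.
    by rewrite f_conj ?J_C // !mulgA mulVg mul1g mulgVK.
  rewrite f_id; last by apply/negP => /C_off; rewrite yx.
  move: yx; rewrite in_st => /orP[/eqP -> | xy]; first by rewrite mulVg mul1g.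
  by rewrite -mulgA -(gen_comm xy) mulKg.
exists (c * f); split.
- by apply: subM Af; apply: gen_in; constructor 1.
- rewrite outerM (_ : outer c = 1) ?mul1g //.
  by apply/esym/outer_eq; rewrite invg1 mul1g.
- by apply: preserves_special_id => y /v_sub_J/g_J.
- exact: preserves_special_id.
Qed.

Lemma representative f : Aut0 Gamma f ->
  exists g, [/\ Aut0 Gamma g, outer g = outer f, preserves g A_v & preserves g A_J].
Proof.
elim=> {f} [f /generator_representative // | | f h _ [f' [Af f'E fv fJ]] _
    [h' [Ah h'E hv hJ]] | f _ [f' [Af f'E fv fJ]]].
- by exists 1; split=> //; [exact: sub1 | exact: preserves1 | exact: preserves1].
- exists (f' * h'); split; [exact: subM | | exact: preservesM | exact: preservesM].
  by rewrite !outerM f'E h'E.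
- exists f'^-1; split; [exact: subV | | exact: preservesV | exact: preservesV].
  have outerV (k : aut (raag Gamma)) : outer k^-1 = (outer k)^-1.
    exact: (morphV (@projM _ (inn _))).
  by rewrite !outerV f'E.
Qed.

End Classes.

(** * The automorphisms of A_J and A_L induced by a representative *)

Section Induced.
Variables (Gamma : sgraph) (v : Gamma).

Notation A_v := (special (vclass v)).
Notation A_L := (special (L_of v)).
Notation A_J := (special (J_of v)).
Implicit Types (f : aut (raag Gamma)) (fJ : aut (subg A_J)) (fL : aut (subg A_L)).

(** A relation treating restriction and projection together, so that compatibility with products,
    inverses and inner automorphisms is checked once for both. *)
Definition induces f (p : aut (subg A_J) * aut (subg A_L)) :=
  restriction_of f p.1 /\
  exists2 fQ, quotient_of p.1 fQ & transports (@L_iso _ v) p.2 fQ.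

Lemma restriction_preserves f fJ :
  preserves f A_v -> restriction_of f fJ -> preserves fJ (class_in_J v).
Proof.
move=> /preservesP[fv vf] res; apply/preservesP; split=> [x vx | y /vf[x vx fx]].
  by move: (fv _ vx); rewrite -res.
have Jx : A_J x by apply: specialS vx; apply: finset.subsetUr.
by exists (to_subg Jx) => //; apply: val_inj; rewrite res.
Qed.

Lemma induces_ex f : preserves f A_v -> preserves f A_J -> exists p, induces f p.
Proof.
move=> fv /restriction_ex[fJ res].
have [fQ qf] := quotient_ex (restriction_preserves fv res).
have [fL tf] := transports_ex fQ (@L_isoM _ v) (@L_iso_bij _ v).
by exists (fJ, fL); split=> //; exists fQ.
Qed.

Lemma inducesM f g p q :
  induces f p -> induces g q -> induces (f * g) (p.1 * q.1, p.2 * q.2).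
Proof.
move=> [resf [fQ qf tf]] [resg [gQ qg tg]]; split=> [x|].
  by rewrite -[RHS]/(f (g (val x))) -resg -resf.
exists (fQ * gQ) => x.
  by rewrite -[LHS]/(fQ (gQ (proj _ x))) qg qf.
by rewrite -[RHS]/(fQ (gQ (L_iso x))) -tg -tf.
Qed.

Lemma inducesV f p : induces f p -> induces f^-1 (p.1^-1, p.2^-1).
Proof.
have autK (G : groupType) (h : aut G) : cancel h h^-1 by apply: aut_invK.
have autKV (G : groupType) (h : aut G) : cancel h^-1 h by apply: aut_Kinv.
move=> [resf [fQ qf tf]]; split=> [x /=|].
  by apply: (can_inj (autK _ f)); rewrite -resf !autKV.
exists fQ^-1 => x /=; apply: (can_inj (autK _ fQ)).
  by rewrite autKV qf autKV.
by rewrite -tf !autKV.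
Qed.

Lemma induces_inner f p : is_inner f -> induces f p -> is_inner p.1 /\ is_inner p.2.
Proof.
case: p => fJ fL f_inn [/= resf [fQ qf tf]].
have fJ_inn : is_inner fJ := restriction_inner f_inn resf; split=> //.
have [j jE] := fJ_inn; have [i iK Ki] := @L_iso_bij _ v.
(* The conjugator on A_L is the image of [j] in A_J / A_[v], pulled back along the inverse [i] of
   [L_iso]. *)
exists (i (proj _ j)) => x; apply: (can_inj iK).
rewrite tf !L_isoM (morphV (@L_isoM _ v)) Ki -[in LHS](projK (L_iso x)).
by rewrite qf jE !projM projK (morphV (@projM _ _)).
Qed.

(** Independence of the representative: [f^-1 * g] is inner and induces the componentwise
    [p^-1 * q]. *)
Lemma induces_outer f g p q : outer f = outer g -> induces f p -> induces g q ->
  outer p.1 = outer q.1 /\ outer p.2 = outer q.2.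
Proof.
move=> /outer_eq fg_inn /inducesV fp gq.
by have [] := induces_inner fg_inn (inducesM fp gq) => /outer_eq ? /outer_eq.
Qed.

End Induced.

(** * Assembly of the restriction and projection homomorphisms *)

Theorem corollary3p3 (Gamma : sgraph) (Gamma_connected : connected Gamma)
    (v : Gamma) (v_max : maximal_class v) :
  let A_v := special (vclass v) in
  let A_L := special (L_of v) in
  let A_J := special (J_of v) in
  exists (R : {multiplicative subg (Out0 Gamma) -> out (subg A_J)})
         (P : {multiplicative subg (Out0 Gamma) -> out (subg A_L)}),
  forall phi : subg (Out0 Gamma),
    (exists f : aut (raag Gamma),
       [/\ Aut0 Gamma f, outer f = val phi, preserves f A_v
         & preserves f A_J])
    /\
    (forall f : aut (raag Gamma),
       Aut0 Gamma f -> outer f = val phi ->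
       preserves f A_v -> preserves f A_J ->
       exists (fJ : aut (subg A_J)) (fQ : aut (quot (class_in_J v)))
              (fL : aut (subg A_L)),
         [/\ restriction_of f fJ,
             R phi = outer fJ,
             quotient_of fJ fQ,
             transports (@L_iso _ v) fL fQ
           & P phi = outer fL]).
Proof.
move=> A_v A_L A_J.
have rep (phi : subg (Out0 Gamma)) : exists f,
    [/\ Aut0 Gamma f, outer f = val phi, preserves f A_v & preserves f A_J].
  by have [f Af <-] := subgP phi; apply: representative.
have ind (phi : subg (Out0 Gamma)) : exists fp : _ * _,
    outer fp.1 = val phi /\ @induces _ v fp.1 fp.2.
  have [f [_ fE fv fJ]] := rep phi; have [p fp] := induces_ex fv fJ.
  by exists (f, p).
(* An arbitrary choice of representative with its induced pair; [sE] shows that the outer classes do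
   not depend on it. *)
pose s phi := projT1 (cid (ind phi)).
have sE phi f p : outer f = val phi -> induces f p ->
    outer (s phi).2.1 = outer p.1 /\ outer (s phi).2.2 = outer p.2.
  move=> fE fp; rewrite /s; case: cid => -[g q] /= [gE gq].
  by apply: induces_outer gq fp; rewrite gE fE.
have sM phi psi :
    outer (s (phi * psi)).2.1 = outer (s phi).2.1 * outer (s psi).2.1 /\
    outer (s (phi * psi)).2.2 = outer (s phi).2.2 * outer (s psi).2.2.
  (* The product of the representatives chosen for [phi] and [psi] represents [phi * psi], so [sE]
     compares it with the one chosen there. *)
  have [fE fp] := projT2 (cid (ind phi)); have [gE gq] := projT2 (cid (ind psi)).
  rewrite -!outerM; apply: sE (inducesM fp gq).
  by rewrite outerM fE gE.
pose R phi := outer (s phi).2.1; pose P phi := outer (s phi).2.2.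
pose RM := isMultiplicative.Build _ _ R (fun x y => proj1 (sM x y)).
pose PM := isMultiplicative.Build _ _ P (fun x y => proj2 (sM x y)).
pose Rm : {multiplicative subg (Out0 Gamma) -> out (subg A_J)} := HB.pack R RM.
pose Pm : {multiplicative subg (Out0 Gamma) -> out (subg A_L)} := HB.pack P PM.
exists Rm, Pm => phi; split=> [|f Af fE fv fJ].
  exact: rep.
have [[fJ' fL] fp] := induces_ex fv fJ; have [RE PE] := sE _ _ _ fE fp.
by case: fp => resf [fQ qf tf]; exists fJ', fQ, fL.
Qed.
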